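(* Let $\mathbb{F}$ be an algebraically closed field of characteristic $0$, let $f(w)=\sum_{i=-1}^{L}f_iw^{i+1}\in\mathbb{F}[w]$, and let $p(x,y)=\sum_{i=0}^{L}f_i\sum_{j=0}^i x^jy^{i-j}=\frac{f(x)-f(y)}{x-y}$, assumed non-constant. Let $X\in\mathbb{F}^{M\times M}$, $Y\in\mathbb{F}^{N\times N}$ and $P(X,Y)=\sum_{i=0}^{L}f_i\left(\sum_{j=0}^iX^j\otimes Y^{i-j}\right)$. Consider a pair consisting of a Jordan block in the Jordan canonical form of $X$ and a Jordan block in that of $Y$, of sizes $m$ and $n$ respectively and sharing the same eigenvalue $\lambda$, where without loss of generality $m\le n$. Let $d\ge1$ be the multiplicity of $\lambda$ as a root of the polynomial $\hat\partial_w\phi(w)$, where $\phi(w)=f(w)-w\,\hat\partial_wf(\lambda)$. For every positive integer $\ell$ and every $d\ell+1\le k\le m+n-1$, let $\rho(k,m,n,d,\ell)$ be the rank of the integer Toeplitz matrix $R_k=R_k(m,n,d,\ell)$ defined in the context. For integers $s\ge0$ let $$\mathfrak{N}_s:=\begin{cases}0&\text{if }s=0;\\ mn-\sum_{k=ds+1}^{m+n-1}\rho(k,m,n,d,s)&\text{if }0<sd<m+n-1;\\ mn&\text{otherwise.}\end{cases}$$ Then, for each such pair of Jordan blocks, the Jordan blocks associated with it in the Jordan canonical form of $P(X,Y)$ are as follows: (i) if $d\ge m+n-1$, there are $mn$ Jordan blocks of size $1$ and eigenvalue $\hat\partial_wf(\lambda)$; (ii) if $d<m+n-1$, there are, for every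 $s\ge1$, precisely $n_s:=2\mathfrak{N}_s-\mathfrak{N}_{s-1}-\mathfrak{N}_{s+1}$ Jordan blocks of size $s$ and eigenvalue $\hat\partial_wf(\lambda)$.
   Context: $\otimes$ is the Kronecker product; $\hat\partial_w=\frac{d}{dw}$ is the (first Hasse) formal derivative; $J_m(\lambda)$ is the $m\times m$ (upper triangular) Jordan block with eigenvalue $\lambda$. ''Associated with a pair of Jordan blocks'': $P(X,Y)$ is similar to the direct sum of the matrices $P(J_m(\lambda),J_n(\mu))$ over all pairs consisting of a Jordan block $J_m(\lambda)$ of $X$ and a Jordan block $J_n(\mu)$ of $Y$ (counted with multiplicity), and the Jordan blocks associated with a pair are those of the Jordan canonical form of the summand $P(J_m(\lambda),J_n(\mu))$. Definition of $R_k$. Fix positive integers $m,n,d,\ell,k$ with $m\le n$ and $d\ell+1\le k\le m+n-1$. For $1\le j\le m+n-1$ put $u_j=\min(j,m,m+n-j)$. For $0\le i\le\ell d$ define $\gamma_i$ by $\sum_{i=0}^{\ell d}\gamma_iz^i=(1+z+\dots+z^d)^\ell$, and set $\gamma_i=0$ for every other integer $i$. Put $c_k=0$ if $k\le n$, $c_k=k-n$ if $n\le k\le n+\ell d$, and $c_k=\ell d$ if $k\ge n+\ell d$. Then $R_k\in\mathbb{Z}^{u_{k-\ell d}\times u_k}$ is the Toeplitz matrix with entries $(R_k)_{ij}=\gamma_{j-i+c_k}$. (Its rank is the usual matrix rank over $\mathbb{Q}$, equivalently over $\mathbb{F}$.) *)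

(* Defs.v *)
From HB Require Import structures.
From mathcomp Require Import all_boot all_order all_algebra.
From mathcomp Require Import mxtens.

Set Implicit Arguments.
Unset Strict Implicit.
Unset Printing Implicit Defensive.

Import Order.TTheory GRing.Theory Num.Theory.
Local Open Scope ring_scope.

Section JordanForms.
Variable F : fieldType.

(* A Jordan block is recorded by the pair (size, eigenvalue). *)
Definition jordan_block (u : nat * F) : 'M[F]_u.1 :=
  \matrix_(i, j) (u.2 *+ (i == j) + (i.+1 == j :> nat)%:R).

Definition jordan_dim (s : seq (nat * F)) : nat :=
  (\sum_(i < size s) (tnth (in_tuple s) i).1)%N.

Definition jordan_mx (s : seq (nat * F)) : 'M[F]_(jordan_dim s) :=
  \mxdiag_(i < size s) jordan_block (tnth (in_tuple s) i).

(* s lists, with multiplicity and in some order, the blocks of the Jordan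
   canonical form of A. *)
Definition jordan_form (n : nat) (A : 'M[F]_n) (s : seq (nat * F)) : Prop :=
  all (fun u => 0 < u.1)%N s /\
  exists e : jordan_dim s = n,
    A ~_{in unitmx} castmx (e, e) (jordan_mx s).

End JordanForms.

Section DividedDifference.
Variable F : fieldType.

(* For f(w) = \sum_(-1 <= i <= L) f_i w^(i+1), the coefficient f_i is f`_i.+1.
   Below, x is 'X and y is the inner variable 'X%:P of {poly {poly F}}. *)
Definition divdiff_poly (L : nat) (f : {poly F}) : {poly {poly F}} :=
  \sum_(i < L.+1) (f`_i.+1)%:P%:P *
    \sum_(j < i.+1) 'X ^+ j * ('X%:P) ^+ (i - j).

Definition divdiff_mx (L : nat) (f : {poly F}) (M N : nat)
    (X : 'M[F]_M) (Y : 'M[F]_N) : 'M[F]_(M * N) :=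
  \sum_(i < L.+1) f`_i.+1 *: \sum_(j < i.+1) (X ^+ j) *t (Y ^+ (i - j)).

Definition phi (f : {poly F}) (lambda : F) : {poly F} :=
  f - 'X * (f^`().[lambda])%:P.

End DividedDifference.

Section Toeplitz.

Definition gamma (d l : nat) (i : int) : int :=
  if i is Posz t then ((\sum_(a < d.+1) 'X^a : {poly int}) ^+ l)`_t else 0.

Definition udim (m n j : nat) : nat := minn j (minn m (m + n - j)).

Definition cshift (n d l k : nat) : nat :=
  if (k <= n)%N then 0%N else if (k <= n + l * d)%N then (k - n)%N
  else (l * d)%N.

Definition Rmx (k m n d l : nat) :
    'M[int]_(udim m n (k - l * d), udim m n k) :=
  \matrix_(i, j) gamma d l (j%:Z - i%:Z + (cshift n d l k)%:Z).

Definition rho (k m n d l : nat) : nat :=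
  \rank (map_mx (intr : int -> rat) (Rmx k m n d l)).

Definition frakN (m n d s : nat) : int :=
  if s == 0%N then 0
  else if (0 < s * d < m + n - 1)%N then
    (m * n)%:Z - \sum_(d * s + 1 <= k < m + n) (rho k m n d s)%:Z
  else (m * n)%:Z.

End Toeplitz.

(* Main.v *)
Require Import Defs.
From HB Require Import structures.
From mathcomp Require Import all_boot all_order all_algebra.
From mathcomp Require Import mxtens zify ring.

(** The Jordan form of P(X, Y) splits along pairs of Jordan blocks because tensor
    products, hence divided differences, are additive and functorial in each
    argument ([jordan_divdiff]). It remains to study one pair of blocks, of sizes m
    and n with a common eigenvalue c, whose block sizes are governed by the ranks of
    the powers of P - mu, where mu = f'(c) ([jordan_form_count]).

    Near c, write f(X) = f(c) + mu (X - c) + al (X - c)^(d+1) q(X) with q(c) = 1 and al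
    nonzero; the order d + 1 is one more than the multiplicity of c as a root of
    the derivative of phi, as the characteristic is 0 ([phi_deriv_order]). In
    characteristic 0, q has a (d+1)-th root w modulo any power of X - c
    ([poly_root_approx]), so with W = (X - c) w the non-linear part of f is
    al W^(d+1) up to a term divisible by (X - c)^(m+n), whose divided difference
    vanishes on the two blocks. The divided difference of W^(d+1) is
      (W(x) - W(y)) / (x - y) * (W(x)^d + W(x)^(d-1) W(y) + ... + W(y)^d),
    whose first factor is a unit ([divdiff_leading]). Moreover W sends a Jordan
    block to a nilpotent matrix of maximal index, that is, to a nilpotent Jordan
    block up to similarity ([polymx_jordan_block]). Therefore the powers of P - mu
    have the same ranks as those of x^d + x^(d-1) y + ... + y^d acting on
    F[x, y] / (x^m, y^n) ([rank_divdiff_jordan]).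

    This last operator is homogeneous. Its s-th power has the coefficients of
    (1 + z + ... + z^d)^s, and it splits by total degree into the Toeplitz blocks R_k
    ([rank_graded], [rank_tens_hsum_jordan]), whose ranks over rat and over F
    agree. Hence frakN is the nullity of the s-th power of P - mu ([frakN_rank]), and
    its second difference counts the blocks of size s. *)

Set Implicit Arguments.
Unset Strict Implicit.
Unset Printing Implicit Defensive.

Import Order.TTheory GRing.Theory Num.Theory.
Local Open Scope ring_scope.

(** * Similarity across dimensions, and Jordan forms *)

(** Similarity of square matrices whose sizes need only be provably equal: the
    change of basis is a mutually inverse pair of rectangular matrices, so that
    reindexing a block decomposition never transports a matrix along an equality
    of dimensions. *)
Definition mxsim (F : fieldType) (m n : nat) (A : 'M[F]_m) (B : 'M[F]_n) :=
  exists P : 'M[F]_(m, n), exists Q : 'M[F]_(n, m),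
    [/\ P *m Q = 1%:M, Q *m P = 1%:M & A *m P = P *m B].

Lemma mxsim_refl (F : fieldType) n (A : 'M[F]_n) : mxsim A A.
Proof. by exists 1%:M, 1%:M; rewrite !mulmx1 mul1mx. Qed.

Lemma mxsim_sym (F : fieldType) m n (A : 'M[F]_m) (B : 'M[F]_n) :
  mxsim A B -> mxsim B A.
Proof.
case=> P [Q [PQ QP AP]]; exists Q, P; split=> //.
by rewrite -[B *m Q]mul1mx -QP -mulmxA [P *m (_ *m _)]mulmxA -AP -mulmxA PQ mulmx1.
Qed.

Lemma mxsim_trans (F : fieldType) m n p (A : 'M[F]_m) (B : 'M[F]_n)
    (C : 'M[F]_p) : mxsim A B -> mxsim B C -> mxsim A C.
Proof.
case=> P [Q [PQ QP AP]] [P' [Q' [PQ' QP' AP']]].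
exists (P *m P'), (Q' *m Q); split.
- by rewrite -mulmxA [P' *m _]mulmxA PQ' mul1mx.
- by rewrite -mulmxA [Q *m _]mulmxA QP mul1mx.
- by rewrite mulmxA AP -!mulmxA AP'.
Qed.

Lemma mxsim_dim (F : fieldType) m n (A : 'M[F]_m) (B : 'M[F]_n) :
  mxsim A B -> m = n.
Proof.
case=> P [Q [PQ QP _]].
have le_rank p q (U : 'M[F]_(p, q)) V : U *m V = 1%:M -> (p <= q)%N.
  move=> UV; rewrite -(mxrank1 F p) -UV.
  exact: leq_trans (mxrankM_maxl _ _) (rank_leq_col _).
by apply/eqP; rewrite eqn_leq (le_rank _ _ _ _ PQ) (le_rank _ _ _ _ QP).
Qed.

Lemma mxsim_castmx (F : fieldType) m n (e : m = n) (A : 'M[F]_m) :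
  mxsim A (castmx (e, e) A).
Proof. by case: n / e; rewrite castmx_id; apply: mxsim_refl. Qed.

Lemma simmx_mxsim (F : fieldType) n (A B : 'M[F]_n) :
  A ~_{in unitmx} B <-> mxsim A B.
Proof.
split=> [[P uP /(simmxP uP) PA]|[P [Q [PQ QP AP]]]].
  apply: mxsim_sym; exists P, (invmx P).
  by rewrite mulmxV ?mulVmx // PA.
have [uP uQ] := mulmx1_unit QP.
exists Q => //; apply/simmxP => //.
by rewrite -[LHS]mulmx1 -PQ -mulmxA [A *m _]mulmxA AP !mulmxA QP mul1mx.
Qed.

(** The only place where the transport in the definition of a Jordan form is
    opened. *)
Lemma jordan_formP (F : fieldType) n (A : 'M[F]_n) (s : seq (nat * F)) :
  jordan_form A s <->
  all (fun u => 0 < u.1)%N s /\ mxsim A (jordan_mx s).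
Proof.
split=> [[s_gt0 [e /simmx_mxsim sA]]|[s_gt0 sA]]; split=> //.
  exact: mxsim_trans sA (mxsim_sym (mxsim_castmx e _)).
have e := esym (mxsim_dim sA); exists e; apply/simmx_mxsim.
exact: mxsim_trans sA (mxsim_castmx e _).
Qed.

Lemma mxsim_block (F : fieldType) m n p q (A : 'M[F]_m) (B : 'M[F]_n)
    (C : 'M[F]_p) (D : 'M[F]_q) :
  mxsim A C -> mxsim B D -> mxsim (block_mx A 0 0 B) (block_mx C 0 0 D).
Proof.
case=> P [Q [PQ QP AP]] [P' [Q' [PQ' QP' AP']]].
exists (block_mx P 0 0 P'), (block_mx Q 0 0 Q').
by rewrite !mulmx_block ?(mul0mx, mulmx0, addr0, add0r) PQ QP PQ' QP' AP AP'
  !scalar_mx_block.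
Qed.

Lemma mxsim_blockA (F : fieldType) m n p (A : 'M[F]_m) (B : 'M[F]_n)
    (C : 'M[F]_p) :
  mxsim (block_mx A 0 0 (block_mx B 0 0 C)) (block_mx (block_mx A 0 0 B) 0 0 C).
Proof.
have /= := @block_mxA F m n p m n p A 0 0 0 B 0 0 0 C.
rewrite !row_mx0 !col_mx0 => ->.
exact: mxsim_sym (mxsim_castmx _ _).
Qed.

Lemma mxsim_dim0 (F : fieldType) m n (A : 'M[F]_m) (B : 'M[F]_n) :
  m = 0%N -> n = 0%N -> mxsim A B.
Proof.
move=> m0 n0; move: A B; rewrite m0 n0 => A B.
by exists 0, 0; rewrite [1%:M]flatmx0 !mul0mx mulmx0.
Qed.

Lemma mxsim_block0 (F : fieldType) m n (A : 'M[F]_m) (B : 'M[F]_n) :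
  m = 0%N -> mxsim (block_mx A 0 0 B) B.
Proof.
move=> m0; move: A; rewrite m0 => A.
exists (col_mx 0 1%:M), (row_mx 0 1%:M); split.
- rewrite mul_col_row mulmx0 mul0mx mulmx0 mulmx1.
  rewrite [RHS](@scalar_mx_block F 0 n).
  by congr (block_mx _ 0 0 _); rewrite [RHS]flatmx0.
- by rewrite mul_row_col mulmx0 add0r mulmx1.
- by rewrite mul_block_col mul_col_mx !mulmx0 !mul0mx !add0r mulmx1 mul1mx.
Qed.

Lemma mxsim_mxdiag (F : fieldType) k (p q : 'I_k -> nat)
    (A : forall i, 'M[F]_(p i)) (B : forall i, 'M[F]_(q i)) :
  (forall i, mxsim (A i) (B i)) -> mxsim (\mxdiag_i A i) (\mxdiag_i B i).
Proof.
elim: k p q A B => [|k IHk] p q A B sAB.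
  by apply: mxsim_dim0; rewrite big_ord0.
rewrite !mxdiag_recl.
apply: mxsim_trans (mxsim_sym (mxsim_castmx _ _)) _.
apply: mxsim_trans _ (mxsim_castmx _ _).
by apply: mxsim_block => //; apply: IHk.
Qed.

Lemma jordan_mx_cons (F : fieldType) (u : nat * F) s :
  mxsim (jordan_mx (u :: s)) (block_mx (jordan_block u) 0 0 (jordan_mx s)).
Proof.
rewrite /jordan_mx [X in mxsim X _]mxdiag_recl.
apply: mxsim_trans (mxsim_sym (mxsim_castmx _ _)) _.
apply: mxsim_block; first by rewrite (tnth_nth u); apply: mxsim_refl.
apply: mxsim_mxdiag => i.
rewrite !(tnth_nth u) /=; exact: mxsim_refl.
Qed.

Lemma jordan_mx_cat (F : fieldType) (s t : seq (nat * F)) :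
  mxsim (jordan_mx (s ++ t)) (block_mx (jordan_mx s) 0 0 (jordan_mx t)).
Proof.
elim: s => [|u s IHs] /=.
  by apply: mxsim_sym (mxsim_block0 _ _ _); rewrite /jordan_dim big_ord0.
apply: mxsim_trans (jordan_mx_cons _ _) _.
apply: mxsim_trans (mxsim_block (mxsim_refl _) IHs) _.
apply: mxsim_trans (mxsim_blockA _ _ _) _.
exact: mxsim_block (mxsim_sym (jordan_mx_cons _ _)) (mxsim_refl _).
Qed.

(** * Divided differences of block and Jordan matrices *)

Lemma mulmx_exp_comm (F : fieldType) m n (A : 'M[F]_m) (B : 'M[F]_n)
    (P : 'M[F]_(m, n)) i : A *m P = P *m B -> A ^+ i *m P = P *m B ^+ i.
Proof.
move=> AP; elim: i => [|i IHi]; first by rewrite !expr0 mul1mx mulmx1.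
by rewrite !exprSr -!mulmxE -mulmxA AP !mulmxA IHi.
Qed.

(** Intertwiners of the two arguments tensor to an intertwiner of the divided
    differences. With invertible intertwiners this gives invariance under
    similarity; with the inclusions of the two diagonal blocks it gives the
    splitting of a divided difference along a direct sum. *)
Lemma divdiff_mx_comm (F : fieldType) L f m n p q (A : 'M[F]_m) (B : 'M[F]_n)
    (C : 'M[F]_p) (D : 'M[F]_q) P Q : A *m P = P *m C -> B *m Q = Q *m D ->
  divdiff_mx L f A B *m (P *t Q) = (P *t Q) *m divdiff_mx L f C D.
Proof.
move=> AP BQ; rewrite /divdiff_mx mulmx_suml mulmx_sumr; apply: eq_bigr => i _.
rewrite -scalemxAl -scalemxAr; congr (_ *: _).
rewrite mulmx_suml mulmx_sumr; apply: eq_bigr => j _.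
by rewrite !tensmx_mul !(mulmx_exp_comm _ AP, mulmx_exp_comm _ BQ).
Qed.

Lemma tens_scalar_mx1 (F : fieldType) m n :
  (1%:M : 'M[F]_m) *t (1%:M : 'M[F]_n) = 1%:M.
Proof.
apply/matrixP => i j.
case: (mxtens_indexP i) => i1 i2; case: (mxtens_indexP j) => j1 j2.
by rewrite tensmxE !mxE -natrM mulnb (can_eq (@mxtens_indexK m n)) xpair_eqE.
Qed.

Lemma mxsim_divdiff (F : fieldType) L f m n p q (A : 'M[F]_m) (B : 'M[F]_n)
    (C : 'M[F]_p) (D : 'M[F]_q) : mxsim A C -> mxsim B D ->
  mxsim (divdiff_mx L f A B) (divdiff_mx L f C D).
Proof.
case=> P [Q [PQ QP AP]] [P' [Q' [PQ' QP' AP']]].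
exists (P *t P'), (Q *t Q'); rewrite !tensmx_mul PQ PQ' QP QP'.
by rewrite !tens_scalar_mx1 (divdiff_mx_comm L f AP AP').
Qed.

Lemma tensmxDl (R : pzRingType) m n p q (A B : 'M[R]_(m, n)) (C : 'M[R]_(p, q)) :
  (A + B) *t C = A *t C + B *t C.
Proof. by apply/matrixP => i j; rewrite !mxE mulrDl. Qed.

Lemma mxsim_divdiff_blockl (F : fieldType) L f m n p
    (A : 'M[F]_m) (B : 'M[F]_n) (Y : 'M[F]_p) :
  mxsim (divdiff_mx L f (block_mx A 0 0 B) Y)
        (block_mx (divdiff_mx L f A Y) 0 0 (divdiff_mx L f B Y)).
Proof.
pose D := block_mx A 0 0 B.
have cA : D *m col_mx 1%:M 0 = col_mx 1%:M 0 *m A.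
  by rewrite mul_block_col mul_col_mx !(mulmx0, mul0mx, mulmx1, mul1mx, addr0).
have cB : D *m col_mx 0 1%:M = col_mx 0 1%:M *m B.
  by rewrite mul_block_col mul_col_mx !(mulmx0, mul0mx, mulmx1, mul1mx, add0r).
have cY : Y *m 1%:M = 1%:M *m Y by rewrite mulmx1 mul1mx.
exists (row_mx (col_mx 1%:M 0 *t 1%:M) (col_mx 0 1%:M *t 1%:M)).
exists (col_mx (row_mx 1%:M 0 *t 1%:M) (row_mx 0 1%:M *t 1%:M)); split.
- rewrite mul_row_col !tensmx_mul !mulmx1 -tens_scalar_mx1 !mul_col_row.
  rewrite !(mulmx0, mul0mx, mulmx1) scalar_mx_block.
  by rewrite -tensmxDl add_block_mx !addr0 add0r.
- rewrite mul_col_row !tensmx_mul !mul_row_col !(mulmx0, mul0mx, mulmx1).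
  by rewrite !(addr0, add0r) !tens0mx !tens_scalar_mx1 scalar_mx_block.
- rewrite mul_mx_row (divdiff_mx_comm L f cA cY) (divdiff_mx_comm L f cB cY).
  by rewrite mul_row_block !mulmx0 addr0 add0r.
Qed.

Definition tens_swap (F : fieldType) m n : 'M[F]_(m * n, n * m) :=
  \matrix_(i, j)
    (mxtens_unindex j == ((mxtens_unindex i).2, (mxtens_unindex i).1))%:R.

Lemma tens_swapE (F : fieldType) m n (i : 'I_m) (j : 'I_n) k l :
  tens_swap F m n (mxtens_index (i, j)) (mxtens_index (k, l)) =
  ((k, l) == (j, i))%:R.
Proof. by rewrite mxE !mxtens_indexK. Qed.

Lemma tens_swapK (F : fieldType) m n :
  tens_swap F m n *m tens_swap F n m = 1%:M.
Proof.
apply/matrixP => i j.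
case: (mxtens_indexP i) => i1 i2; case: (mxtens_indexP j) => j1 j2.
rewrite mxE (bigD1 (mxtens_index (i2, i1))) //= big1 => [|k].
  rewrite !tens_swapE mxE eqxx mul1r addr0.
  by rewrite (can_eq (@mxtens_indexK m n)) eq_sym.
case: (mxtens_indexP k) => k1 k2; rewrite (can_eq (@mxtens_indexK n m)) => ne.
by rewrite tens_swapE (negPf ne) mul0r.
Qed.

Lemma tens_swap_comm (F : fieldType) m n p q (A : 'M[F]_(m, p))
    (B : 'M[F]_(n, q)) :
  (A *t B) *m tens_swap F p q = tens_swap F m n *m (B *t A).
Proof.
apply/matrixP => i j.
case: (mxtens_indexP i) => i1 i2; case: (mxtens_indexP j) => j1 j2.
rewrite [LHS]mxE [RHS]mxE (bigD1 (mxtens_index (j2, j1))) //=.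
rewrite [in RHS](bigD1 (mxtens_index (i2, i1))) //=.
rewrite !big1 => [|k|k].
- by rewrite !tens_swapE !tensmxE !eqxx mulr1 mul1r !addr0 mulrC.
- case: (mxtens_indexP k) => k1 k2; rewrite (can_eq (@mxtens_indexK n m)) => ne.
  by rewrite tens_swapE (negPf ne) mul0r.
- case: (mxtens_indexP k) => k1 k2; rewrite (can_eq (@mxtens_indexK p q)) => ne.
  rewrite tens_swapE; case: eqP => [[e1 e2]|]; last by rewrite mulr0.
  by rewrite e1 e2 eqxx in ne.
Qed.

(** The divided difference is a symmetric polynomial in its two variables. *)
Lemma mxsim_divdiffC (F : fieldType) L f m n (A : 'M[F]_m) (B : 'M[F]_n) :
  mxsim (divdiff_mx L f A B) (divdiff_mx L f B A).
Proof.
exists (tens_swap F m n), (tens_swap F n m); rewrite !tens_swapK; split=> //.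
rewrite /divdiff_mx mulmx_suml mulmx_sumr; apply: eq_bigr => i _.
rewrite -scalemxAl -scalemxAr; congr (_ *: _).
rewrite mulmx_suml mulmx_sumr (reindex_inj rev_ord_inj); apply: eq_bigr => j _.
by rewrite tens_swap_comm /= subSS subKn // -ltnS.
Qed.

Lemma mxsim_divdiff_blockr (F : fieldType) L f m n p
    (A : 'M[F]_m) (B : 'M[F]_n) (X : 'M[F]_p) :
  mxsim (divdiff_mx L f X (block_mx A 0 0 B))
        (block_mx (divdiff_mx L f X A) 0 0 (divdiff_mx L f X B)).
Proof.
apply: mxsim_trans (mxsim_divdiffC _ _ _ _) _.
apply: mxsim_trans (mxsim_divdiff_blockl _ _ _ _ _) _.
by apply: mxsim_block; apply: mxsim_divdiffC.
Qed.

Lemma jordan_divdiff (F : fieldType) L f M N (X : 'M[F]_M) (Y : 'M[F]_N)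
    (jX jY : seq (nat * F)) (b : nat * F -> nat * F -> seq (nat * F)) :
  jordan_form X jX -> jordan_form Y jY ->
  (forall u v, u \in jX -> v \in jY ->
     jordan_form (divdiff_mx L f (jordan_block u) (jordan_block v)) (b u v)) ->
  jordan_form (divdiff_mx L f X Y) (flatten [seq b u v | u <- jX, v <- jY]).
Proof.
case/jordan_formP=> _ sX /jordan_formP[_ sY] hb; apply/jordan_formP; split.
  apply/allP => w /flattenP[s /allpairsP[[u v] [uX vY ->]]].
  by have /jordan_formP[/allP/(_ w)] := hb u v uX vY.
apply: mxsim_trans (mxsim_divdiff L f sX sY) _ => {sX sY X Y M N}.
have nil_dim : jordan_dim ([::] : seq (nat * F)) = 0%N.
  by rewrite /jordan_dim big_ord0.
elim: jX hb => [|u jX IHX] hb.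
  by apply: mxsim_dim0; rewrite /= nil_dim.
rewrite allpairs_cons flatten_cat.
apply: mxsim_trans (mxsim_divdiff L f (jordan_mx_cons _ _) (mxsim_refl _)) _.
apply: mxsim_trans (mxsim_divdiff_blockl _ _ _ _ _) _.
apply: mxsim_trans _ (mxsim_sym (jordan_mx_cat _ _)).
apply: mxsim_block; last first.
  by apply: IHX => v w vX wY; apply: hb; rewrite ?inE ?vX ?orbT.
have {}hb v : v \in jY ->
    mxsim (divdiff_mx L f (jordan_block u) (jordan_block v)) (jordan_mx (b u v)).
  by move=> vY; have /jordan_formP[] := hb u v (mem_head _ _) vY.
elim: jY hb {IHX} => [|v jY IHY] hb.
  by apply: mxsim_dim0; rewrite /= nil_dim ?muln0.
apply: mxsim_trans (mxsim_divdiff L f (mxsim_refl _) (jordan_mx_cons _ _)) _.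
apply: mxsim_trans (mxsim_divdiff_blockr _ _ _ _ _) _.
apply: mxsim_trans _ (mxsim_sym (jordan_mx_cat _ _)).
apply: mxsim_block; first by apply: hb; rewrite mem_head.
by apply: IHY => w wY; apply: hb; rewrite inE wY orbT.
Qed.

(** * Block sizes from ranks of powers *)

Lemma mxsim_rank_exp (F : fieldType) m n (A : 'M[F]_m) (B : 'M[F]_n) c t :
  mxsim A B -> \rank ((A - c%:M) ^+ t) = \rank ((B - c%:M) ^+ t).
Proof.
case=> P [Q [PQ QP AP]].
have cP : (A - c%:M) *m P = P *m (B - c%:M).
  by rewrite mulmxBl mulmxBr AP mul_scalar_mx mul_mx_scalar.
have /= cPt := mulmx_exp_comm t cP.
apply/eqP; rewrite eqn_leq; apply/andP; split.
  rewrite -[X in (\rank X <= _)%N]mulmx1 -PQ mulmxA cPt.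
  exact: leq_trans (mxrankM_maxl _ _) (mxrankM_maxr _ _).
rewrite -[X in (\rank X <= _)%N]mul1mx -QP -mulmxA -cPt.
exact: leq_trans (mxrankM_maxr _ _) (mxrankM_maxl _ _).
Qed.

Lemma rank_block_exp (F : fieldType) m n (A : 'M[F]_m) (B : 'M[F]_n) c t :
  \rank ((block_mx A 0 0 B - c%:M) ^+ t) =
  (\rank ((A - c%:M) ^+ t) + \rank ((B - c%:M) ^+ t))%N.
Proof.
rewrite -rank_diag_block_mx; congr (\rank _).
rewrite scalar_mx_block opp_block_mx add_block_mx !subr0.
elim: t => [|t IHt]; first by rewrite !expr0 -scalar_mx_block.
rewrite !exprS IHt -!mulmxE mulmx_block.
by rewrite !(mulmx0, mul0mx, addr0, add0r).
Qed.

Lemma rank_jordan_mx_exp (F : fieldType) (s : seq (nat * F)) c t :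
  \rank ((jordan_mx s - c%:M) ^+ t) =
  (\sum_(u <- s) \rank ((jordan_block u - c%:M) ^+ t))%N.
Proof.
elim: s => [|u s IHs].
  by rewrite big_nil; apply/eqP; rewrite -leqn0
    (leq_trans (rank_leq_row _)) // /jordan_dim big_ord0.
by rewrite big_cons -IHs (mxsim_rank_exp c t (jordan_mx_cons u s)) rank_block_exp.
Qed.

Lemma jordan_block_expE (F : fieldType) n (t : nat) :
  (jordan_block (n, 0 : F)) ^+ t = \matrix_(i, j) ((i + t == j)%N)%:R.
Proof.
elim: t => [|t IHt].
  by rewrite expr0; apply/matrixP=> i j; rewrite !mxE addn0.
rewrite exprS IHt -mulmxE; apply/matrixP=> i j; rewrite !mxE /=.
case: (ltnP i.+1 n) => [lt_in|le_ni].
  rewrite (bigD1 (Ordinal lt_in)) //= big1 => [|k ki].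
    by rewrite !mxE /= mul0rn add0r eqxx mul1r addr0 addSnnS.
  rewrite !mxE /= mul0rn add0r; case: eqP => [ek|]; last by rewrite mul0r.
  by case/eqP: ki; apply: val_inj.
rewrite big1 => [|k _]; last first.
  rewrite !mxE /= mul0rn add0r; case: eqP => [ek|]; last by rewrite mul0r.
  by move: (ltn_ord k); rewrite -ek ltnNge le_ni.
by case: eqP => //= ej; case: i j ej le_ni => i /= lt_i [j /= lt_j] *; exfalso; lia.
Qed.

Lemma jordan_block_shift (F : fieldType) n (c : F) :
  jordan_block (n, c) - c%:M = jordan_block (n, 0).
Proof.
by apply/matrixP=> i j; rewrite !mxE /= mul0rn add0r addrAC subrr add0r.
Qed.

Lemma rank_jordan_block_exp (F : fieldType) n (t : nat) :
  \rank (jordan_block (n, 0 : F) ^+ t) = (n - t)%N.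
Proof.
pose U : 'M[F]_(n, n - t) := \matrix_(i, j) ((i == j :> nat)%:R).
pose V : 'M[F]_(n - t, n) := \matrix_(i, j) ((i + t == j)%N%:R).
have eJ : jordan_block (n, 0 : F) ^+ t = U *m V.
  rewrite jordan_block_expE; apply/matrixP=> i j; rewrite !mxE.
  case: (ltnP i (n - t)) => [lt_i|le_i].
    rewrite (bigD1 (Ordinal lt_i)) //= big1 => [|k ki].
      by rewrite !mxE /= eqxx mul1r addr0.
    rewrite !mxE; case: eqP => [ek|]; last by rewrite mul0r.
    by case/eqP: ki; apply: val_inj.
  rewrite big1 => [|k _].
    by case: eqP => //= ej; case: i j ej le_i => i /= lt_i [j /= lt_j] *; exfalso; lia.
  rewrite !mxE; case: eqP => [ek|]; last by rewrite mul0r.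
  by case: i k ek le_i => i /= lt_i [k /= lt_k] *; exfalso; lia.
have VV : V *m V^T = 1%:M.
  apply/matrixP=> i j; rewrite !mxE.
  have lt_i : (i + t < n)%N by move: (ltn_ord i); lia.
  rewrite (bigD1 (Ordinal lt_i)) //= big1 => [|k ki].
    by rewrite !mxE /= eqxx mul1r addr0 eqn_add2r eq_sym.
  rewrite !mxE; case: eqP => [ek|]; last by rewrite mul0r.
  by case/eqP: ki; apply: val_inj.
have UU : U^T *m U = 1%:M.
  apply/matrixP=> i j; rewrite !mxE.
  have lt_i : (i < n)%N by move: (ltn_ord i); lia.
  rewrite (bigD1 (Ordinal lt_i)) //= big1 => [|k ki].
    by rewrite !mxE /= eqxx mul1r addr0.
  rewrite !mxE; case: eqP => [ek|]; last by rewrite mul0r.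
  by case/eqP: ki; apply: val_inj.
rewrite eJ; apply/eqP; rewrite eqn_leq (leq_trans (mxrankM_maxl _ _)) ?rank_leq_col //=.
rewrite -{1}(mxrank1 F (n - t)).
rewrite -[X in (\rank X <= _)%N]mulmx1 -{1}UU -VV -mulmxA [U *m _]mulmxA.
exact: leq_trans (mxrankM_maxr _ _) (mxrankM_maxl _ _).
Qed.

(** The last standard basis vector is a left eigenvector of a Jordan block. *)
Lemma jordan_block_eigenvalue (F : fieldType) (u : nat * F) c t :
  (0 < u.1)%N -> (jordan_block u - c%:M) ^+ t = 0 -> u.2 = c.
Proof.
case: u => [[//|n] a] _ /= J0.
pose e : 'rV[F]_n.+1 := delta_mx 0 ord_max.
have eJ : e *m (jordan_block (n.+1, a) - c%:M) = (a - c) *: e.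
  rewrite mulmxBr mul_mx_scalar scalerBl; congr (_ - _).
  rewrite -rowE; apply/rowP=> j; rewrite !mxE /=.
  by rewrite (gtn_eqF (ltn_ord j)) addr0 eq_sym mulr_natr.
have eJt : e *m (jordan_block (n.+1, a) - c%:M) ^+ t = (a - c) ^+ t *: e.
  elim: t {J0} => [|t IHt]; first by rewrite !expr0 mulmx1 scale1r.
  by rewrite exprS -mulmxE mulmxA eJ -scalemxAl IHt scalerA -exprS.
move: eJt; rewrite J0 mulmx0 => /rowP/(_ ord_max); rewrite !mxE !eqxx mulr1.
by move/esym/eqP; rewrite expf_eq0 => /andP[_]; rewrite subr_eq0 => /eqP.
Qed.

Lemma jordan_form_eigenvalues (F : fieldType) n (A : 'M[F]_n) s c t :
  jordan_form A s -> (A - c%:M) ^+ t = 0 -> all (fun u => u.2 == c) s.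
Proof.
case/jordan_formP=> /allP s_gt0 sA A0; apply/allP => u us.
have := rank_jordan_mx_exp s c t; rewrite -(mxsim_rank_exp c t sA) A0 mxrank0.
rewrite (big_rem u us) /=; case: eqVneq => // ne_uc /esym/eqP.
rewrite addn_eq0 mxrank_eq0 => /andP[/eqP J0 _].
by case/eqP: ne_uc; apply: jordan_block_eigenvalue J0; apply: s_gt0.
Qed.

Lemma jordan_form_rank (F : fieldType) n (A : 'M[F]_n) s c t :
  jordan_form A s -> all (fun u => u.2 == c) s ->
  \rank ((A - c%:M) ^+ t) = (\sum_(u <- s) (u.1 - t))%N.
Proof.
case/jordan_formP=> _ sA /allP sc.
rewrite (mxsim_rank_exp c t sA) rank_jordan_mx_exp.
rewrite !big_seq; apply: eq_bigr => -[k a] /sc/= /eqP ->.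
by rewrite jordan_block_shift rank_jordan_block_exp.
Qed.

Lemma jordan_form_size (F : fieldType) n (A : 'M[F]_n) s :
  jordan_form A s -> (\sum_(u <- s) u.1)%N = n.
Proof.
case/jordan_formP=> _ /mxsim_dim ->.
by rewrite /jordan_dim [LHS](big_nth (0%N, 0)) big_mkord; apply: eq_bigr => i _;
  rewrite (tnth_nth (0%N, 0)).
Qed.

(** The second difference of t |-> max(k - t, 0) is the indicator function of k,
    which turns ranks of powers into numbers of blocks. *)
Lemma jordan_form_count (F : fieldType) n (A : 'M[F]_n) s c t :
  jordan_form A s -> all (fun u => u.2 == c) s -> (0 < t)%N ->
  (count_mem (t, c) s + 2 * \rank ((A - c%:M) ^+ t) =
   \rank ((A - c%:M) ^+ t.-1) + \rank ((A - c%:M) ^+ t.+1))%N.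
Proof.
move=> jA sc; rewrite !(jordan_form_rank _ jA sc) {jA}.
case: t => // t _; elim: s sc => [|[k a] s IHs]; first by rewrite !big_nil.
rewrite /= !big_cons => /andP[/= /eqP -> /IHs].
rewrite xpair_eqE eqxx andbT /=; case: eqP; lia.
Qed.

(** * Divided differences in an algebra *)

Lemma horner_algE (F : fieldType) (R : algType F) (a : R) (p : {poly F}) n :
  (size p <= n)%N -> horner_alg a p = \sum_(i < n) p`_i *: a ^+ i.
Proof.
move=> le_pn; rewrite [in LHS](_ : p = \poly_(i < n) p`_i); last first.
  apply/polyP=> i; rewrite coef_poly; case: ltnP => // le_ni.
  by rewrite nth_default // (leq_trans le_pn).
rewrite poly_def linear_sum; apply: eq_bigr => i _.
by rewrite linearZ /= rmorphXn /= horner_algX mulr_algl.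
Qed.

(** The complete homogeneous symmetric polynomial of degree k, evaluated at a and
    b. *)
Definition hsum (R : pzRingType) (k : nat) (a b : R) : R :=
  \sum_(j < k.+1) a ^+ j * b ^+ (k - j).

Lemma hsumS (R : pzRingType) k (a b : R) :
  hsum k.+1 a b = hsum k a b * b + a ^+ k.+1.
Proof.
rewrite /hsum big_ord_recr /= subnn expr0 mulr1 mulr_suml; congr (_ + _).
by apply: eq_bigr => i _; rewrite subSn 1?ltnS -1?ltnS // exprSr mulrA.
Qed.

Lemma hsum0 (R : pzRingType) (a b : R) : hsum 0 a b = 1.
Proof. by rewrite /hsum big_ord1 !expr0 mulr1. Qed.

(** The polynomial (p(x) - p(y)) / (x - y), evaluated at (a, b) with powers of a on
    the left. *)
Definition divdiff (F : fieldType) (R : algType F) (p : {poly F}) (a b : R) : R :=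
  \sum_(i < size p) p`_i.+1 *: hsum i a b.

Lemma divdiffE (F : fieldType) (R : algType F) (p : {poly F}) (a b : R) n :
  (size p <= n.+1)%N -> divdiff p a b = \sum_(i < n) p`_i.+1 *: hsum i a b.
Proof.
have wide N k : (size p <= N.+1)%N -> (N <= k)%N ->
    \sum_(i < N) p`_i.+1 *: hsum i a b = \sum_(i < k) p`_i.+1 *: hsum i a b.
  move=> le_pN /subnK <-; rewrite addnC big_split_ord /=.
  rewrite [X in _ = _ + X]big1 ?addr0 // => i _.
  by rewrite nth_default ?scale0r //= (leq_trans le_pN) // ltnS leq_addr.
move=> le_pn; rewrite /divdiff (wide _ (maxn (size p) n)) ?leq_maxl //.
by rewrite -(wide n) ?leq_maxr.
Qed.

Lemma divdiffC (F : fieldType) (R : algType F) c (a b : R) :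
  divdiff c%:P a b = 0.
Proof. by rewrite (@divdiffE _ _ _ a b 0) ?big_ord0 // size_polyC leq_b1. Qed.

Lemma divdiffD (F : fieldType) (R : algType F) p q (a b : R) :
  divdiff (p + q) a b = divdiff p a b + divdiff q a b.
Proof.
have hp : (size p <= (maxn (size p) (size q)).+1)%N by rewrite ltnW // ltnS leq_maxl.
have hq : (size q <= (maxn (size p) (size q)).+1)%N by rewrite ltnW // ltnS leq_maxr.
have hpq : (size (p + q)%R <= (maxn (size p) (size q)).+1)%N.
  by rewrite ltnW // ltnS size_polyD.
rewrite (divdiffE _ _ hp) (divdiffE _ _ hq) (divdiffE _ _ hpq) -big_split /=.
by apply: eq_bigr => i _; rewrite coefD scalerDl.
Qed.

Lemma divdiffZ (F : fieldType) (R : algType F) c p (a b : R) :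
  divdiff (c *: p) a b = c *: divdiff p a b.
Proof.
have hp : (size (c *: p)%R <= (size p).+1)%N by rewrite ltnW // ltnS size_scale_leq.
rewrite (divdiffE _ _ hp) /divdiff scaler_sumr.
by apply: eq_bigr => i _; rewrite coefZ scalerA.
Qed.

Lemma divdiff_mulX (F : fieldType) (R : algType F) p (a b : R) :
  divdiff (p * 'X) a b = divdiff p a b * b + horner_alg a p.
Proof.
have hX : (size (p * 'X)%R <= (size p).+2)%N.
  have [->|p0] := eqVneq p 0; first by rewrite mul0r size_poly0.
  by rewrite size_mulX.
rewrite (divdiffE _ _ hX) (horner_algE a (leqnSn _)) [RHS]addrC !big_ord_recl.
rewrite coefMX /= hsum0 expr0 -addrA; congr (_ + _).
rewrite /divdiff mulr_suml -big_split /=; apply: eq_bigr => i _.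
by rewrite coefMX /= hsumS addrC scalerDr scalerAl.
Qed.

(** Leibniz rule, from p(x) q(x) - p(y) q(y) = p(x) (q(x) - q(y)) + (p(x) - p(y)) q(y).
    Both terms keep a to the left of b. *)
Lemma divdiffM (F : fieldType) (R : algType F) p q (a b : R) :
  divdiff (p * q) a b =
  horner_alg a p * divdiff q a b + divdiff p a b * horner_alg b q.
Proof.
elim/poly_ind: q => [|q c IHq].
  by rewrite mulr0 -[0]/(0%:P) !divdiffC rmorph0 !mulr0 addr0.
rewrite mulrDr mulrA [p * _%:P]mulrC mul_polyC !divdiffD !divdiff_mulX divdiffZ.
rewrite divdiffC IHq !rmorphD !rmorphM /= horner_algX horner_algC addr0.
rewrite mulrDl !mulrDr -!mulrA -mulr_algr -!addrA; congr (_ + _).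
by rewrite addrCA -mulr_algr.
Qed.

Lemma comm_horner_alg (F : fieldType) (R : algType F) (x a : R) p :
  GRing.comm x a -> GRing.comm x (horner_alg a p).
Proof.
move=> xa; rewrite (horner_algE a (leqnn _)); apply: commr_sum => i _.
rewrite -mulr_algl; apply: commrM; first exact/commr_sym/comm_alg.
exact: commrX.
Qed.

Lemma comm_hsum (R : pzRingType) (x a b : R) k :
  GRing.comm x a -> GRing.comm x b -> GRing.comm x (hsum k a b).
Proof.
by move=> xa xb; apply: commr_sum => i _; apply: commrM; apply: commrX.
Qed.

Lemma comm_divdiff (F : fieldType) (R : algType F) (x a b : R) p :
  GRing.comm x a -> GRing.comm x b -> GRing.comm x (divdiff p a b).
Proof.
move=> xa xb; apply: commr_sum => i _; rewrite -mulr_algl.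
apply: commrM; first exact/commr_sym/comm_alg.
exact: comm_hsum.
Qed.

(** Since p(x)^(k+1) - p(y)^(k+1) = (p(x) - p(y)) * hsum k (p(x)) (p(y)). *)
Lemma divdiff_exp (F : fieldType) (R : algType F) p (a b : R) k :
  GRing.comm a b ->
  divdiff (p ^+ k.+1) a b =
  divdiff p a b * hsum k (horner_alg a p) (horner_alg b p).
Proof.
move=> ab.
have cp : GRing.comm (divdiff p a b) (horner_alg a p).
  by apply/comm_horner_alg/commr_sym/comm_divdiff.
elim: k => [|k IHk]; first by rewrite hsum0 mulr1.
rewrite exprSr divdiffM IHk hsumS [RHS]mulrDr mulrA [RHS]addrC rmorphXn /=.
by congr (_ + _); apply/commr_sym/commrX.
Qed.

Lemma divdiff_XsubC (F : fieldType) (R : algType F) c (a b : R) :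
  divdiff ('X - c%:P) a b = 1.
Proof.
rewrite -polyCN divdiffD divdiffC addr0 -[X in divdiff X]mul1r divdiff_mulX.
by rewrite -[1]/(1%:P) divdiffC mul0r add0r horner_algC scale1r.
Qed.

Lemma horner_alg_XsubC (F : fieldType) (R : algType F) c (a : R) :
  horner_alg a ('X - c%:P) = a - c%:A.
Proof. by rewrite rmorphB /= horner_algX horner_algC. Qed.

(** Every monomial of degree m + n - 1 in two variables is divisible by x^m or by
    y^n, so hsum (m + n - 1) vanishes at the pair a - c, b - c. *)
Lemma divdiff_XsubC_exp_mul (F : fieldType) (R : algType F) c (a b : R) m n r :
  GRing.comm a b -> (a - c%:A) ^+ m = 0 -> (b - c%:A) ^+ n = 0 ->
  divdiff (('X - c%:P) ^+ (m + n) * r) a b = 0.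
Proof.
move=> ab a0 b0.
have am i : (m <= i)%N -> (a - c%:A) ^+ i = 0.
  by move/subnK=> <-; rewrite exprD a0 mulr0.
have bn i : (n <= i)%N -> (b - c%:A) ^+ i = 0.
  by move/subnK=> <-; rewrite exprD b0 mulr0.
rewrite divdiffM rmorphXn /= horner_alg_XsubC am ?leq_addr // mul0r add0r.
case e: (m + n)%N => [|k].
  by rewrite expr0 -[1]/(1%:P) divdiffC mul0r.
rewrite divdiff_exp // divdiff_XsubC mul1r !horner_alg_XsubC.
rewrite /hsum big1 ?mul0r // => i _.
case: (leqP m i) => [/am ->|lt_im]; first by rewrite mul0r.
by rewrite bn ?mulr0 //; lia.
Qed.

Lemma unitr_add_nil (R : unitRingType) (u x : R) k :
  u \is a GRing.unit -> GRing.comm u x -> x ^+ k = 0 -> u + x \is a GRing.unit.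
Proof.
move=> Uu ux xk.
pose y := - (u^-1 * x).
have cux : GRing.comm u^-1 x by apply/commr_sym/commrV/commr_sym.
have yk : y ^+ k = 0 by rewrite /y exprNn exprMn_comm // xk !mulr0.
have -> : u + x = u * (1 - y) by rewrite /y opprK mulrDr mulr1 mulVKr.
rewrite unitrMr //.
have e : (1 - y) * (\sum_(i < k) y ^+ i) = 1.
  by have := subrX1 y k; rewrite yk sub0r => /(congr1 -%R);
    rewrite opprK -mulNr opprB.
apply/unitrP; exists (\sum_(i < k) y ^+ i); split=> //.
rewrite -[RHS]e; apply/commr_sym/commr_sum => i _; apply/commrX.
by apply/commr_sym/commrB; [exact: commr1|].
Qed.

Lemma horner1_factor (F : fieldType) (c : F) (w : {poly F}) :
  w.[c] = 1 -> exists s, w = 1 + s * ('X - c%:P).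
Proof.
move=> w1; have /factor_theorem[s es] : root (w - 1) c.
  by rewrite /root hornerD hornerN hornerC w1 subrr.
by exists s; rewrite -es addrC subrK.
Qed.

Lemma horner_alg_unit (F : fieldType) (R : unitAlgType F) (a : R) c
    (w : {poly F}) n :
  (a - c%:A) ^+ n = 0 -> w.[c] = 1 -> horner_alg a w \is a GRing.unit.
Proof.
move=> a0 /horner1_factor[s ->].
rewrite rmorphD rmorph1 rmorphM /= horner_alg_XsubC.
apply: (@unitr_add_nil _ _ _ n); first exact: unitr1.
  exact/commr_sym/commr1.
rewrite exprMn_comm ?a0 ?mulr0 //; apply: commrB.
  exact/commr_sym/comm_horner_alg.
exact/commr_sym/comm_alg.
Qed.

(** Dividing out the unit divdiff W a b leaves the homogeneous form Z in the new
    variables W(a) and W(b); U is a unit because W = (X - c) w with w(c) = 1, so it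
    is w(b) up to a nilpotent. *)
Lemma divdiff_leading (F : fieldType) (R : unitAlgType F) (a b : R) m n
    (c mu al c0 : F) (f w r : {poly F}) d :
  GRing.comm a b -> (a - c%:A) ^+ m = 0 -> (b - c%:A) ^+ n = 0 ->
  w.[c] = 1 ->
  f = c0%:P + mu *: 'X + al *: (('X - c%:P) * w) ^+ d.+1
      + ('X - c%:P) ^+ (m + n) * r ->
  let Z := hsum d (horner_alg a (('X - c%:P) * w))
                  (horner_alg b (('X - c%:P) * w)) in
  exists2 U : R, U \is a GRing.unit /\ GRing.comm U Z &
    divdiff f a b - mu%:A = al *: (U * Z).
Proof.
move=> ab a0 b0 w1 -> /=; set W := ('X - c%:P) * w.
exists (divdiff W a b); last first.
  rewrite !divdiffD divdiffC divdiff_XsubC_exp_mul // addr0 add0r !divdiffZ.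
  rewrite divdiff_exp // -[X in mu *: divdiff X _ _]subr0 -[0]/(0%:P).
  by rewrite divdiff_XsubC addrAC subrr add0r.
split; last first.
  by apply: comm_hsum; apply: comm_horner_alg; apply/commr_sym;
    apply: comm_divdiff => //; apply: commr_sym.
rewrite divdiffM divdiff_XsubC mul1r horner_alg_XsubC addrC.
have ca_a x : GRing.comm x a -> GRing.comm x (a - c%:A).
  by move=> xb; apply: commrB => //; apply/commr_sym/comm_alg.
apply: (@unitr_add_nil _ _ _ m).
- exact: horner_alg_unit b0 w1.
- apply: commrM.
    by apply: ca_a; apply/commr_sym/comm_horner_alg.
  apply: comm_divdiff; apply/commr_sym; apply: comm_horner_alg => //.
- rewrite exprMn_comm ?a0 ?mul0r //.
  apply: comm_divdiff; apply/commr_sym; apply: ca_a => //.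
Qed.

(** * Straightening the leading term *)

Lemma exprD_mod_sqr (R : comPzRingType) (w h : R) e :
  exists t, (w + h) ^+ e.+1 = w ^+ e.+1 + e.+1%:R * w ^+ e * h + h ^+ 2 * t.
Proof.
elim: e => [|e [t IHe]].
  by exists 0; rewrite !expr1 expr0 !mulr1 mul1r mulr0 addr0.
exists (e.+1%:R * w ^+ e + t * (w + h)).
rewrite exprSr IHe (mulrS 1 e.+1) !exprSr; ring.
Qed.

(** A polynomial with value 1 at c has an e.+1-th root modulo any power of X - c, by
    Hensel lifting; characteristic 0 makes the derivative e.+1 of the (e.+1)-th power
    at 1 invertible. *)
Lemma poly_root_approx (F : fieldType) (c : F) (q : {poly F}) e K :
  [pchar F] =i pred0 -> q.[c] = 1 ->
  exists w r, w.[c] = 1 /\ q = w ^+ e.+1 + ('X - c%:P) ^+ K * r.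
Proof.
move=> F0 qc; case: K => [|K].
  by exists 1, (q - 1); rewrite hornerC expr1n expr0 mul1r addrC subrK.
elim: K => [|K [w [r [wc eq]]]].
  have [s ->] := horner1_factor qc.
  by exists 1, s; rewrite hornerC expr1n expr1 mulrC.
pose k := r.[c] / e.+1%:R.
have e0 : e.+1%:R != 0 :> F by move/pcharf0P: F0 => ->.
pose h := k%:P * ('X - c%:P) ^+ K.+1.
have [t et] := exprD_mod_sqr w h e.
(* The correction h cancels the error term of order K.+1 at c. *)
have /factor_theorem[s es] : root (r - e.+1%:R * w ^+ e * k%:P) c.
  rewrite /root hornerD hornerN !hornerM horner_exp wc expr1n hornerMn !hornerC.
  by rewrite mulr1 /k mulrC divfK // subrr.
exists (w + h), (s - k%:P ^+ 2 * ('X - c%:P) ^+ K * t); split.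
  by rewrite /h !hornerE wc subrr expr0n mulr0 addr0.
rewrite et eq /h.
have -> : r = s * ('X - c%:P) + e.+1%:R * w ^+ e * k%:P by rewrite -es subrK.
rewrite !exprS expr0; ring.
Qed.

(** If v A^n is nonzero then the v A^i, for i <= n, form a basis, on which A is a
    shift. *)
Lemma mxsim_nilpotent (F : fieldType) n (A : 'M[F]_n.+1) :
  A ^+ n.+1 = 0 -> A ^+ n != 0 -> mxsim A (jordan_block (n.+1, 0)).
Proof.
move=> A0 An.
have A0i i : (n < i)%N -> A ^+ i = 0.
  by move/subnK=> <-; rewrite exprD A0 mulr0.
have [v vA] : exists v : 'rV_n.+1, v *m A ^+ n != 0.
  have /matrix0Pn[i [j Aij]] := An; exists (delta_mx 0 i); rewrite -rowE.
  by apply/rV0Pn; exists j; rewrite mxE.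
pose S : 'M_n.+1 := \matrix_(i < n.+1) (v *m A ^+ i).
have JS : jordan_block (n.+1, 0) *m S = S *m A.
  apply/row_matrixP => i; rewrite !row_mul rowK -mulmxA mulmxE -exprSr.
  case: (ltnP i.+1 n.+1) => [lt_in|le_ni].
    have -> : row i (jordan_block (n.+1, 0))
        = delta_mx 0 (Ordinal lt_in) :> 'rV[F]_n.+1.
      by apply/rowP => j; rewrite !mxE /= mul0rn add0r -val_eqE /= eq_sym.
    by rewrite -rowE rowK.
  rewrite (A0i i.+1) // mulmx0.
  have -> : row i (jordan_block (n.+1, 0)) = 0 :> 'rV[F]_n.+1.
    apply/rowP => j; rewrite !mxE /= mul0rn add0r gtn_eqF //.
    exact: leq_trans (ltn_ord j) _.
  by rewrite mul0mx.
(* In a vanishing combination, multiplying by A^(n - i) isolates the coefficient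
   of v A^i once those of the lower powers are known to be 0. *)
have uS : S \in unitmx.
  rewrite -row_free_unit; apply: inj_row_free => c cS.
  suff c0 i : (i <= n)%N -> c 0 (inord i) = 0.
    by apply/rowP => i; rewrite mxE -(inord_val i) c0 // -ltnS.
  elim/ltn_ind: i => i IHi le_in.
  have := congr1 (mulmx^~ (A ^+ (n - i))) cS; rewrite /= mul0mx (mulmx_sum_row c).
  rewrite mulmx_suml (bigD1 (inord i)) //= big1 => [|k ki].
    rewrite addr0 rowK inordK ?ltnS // -scalemxAl -mulmxA mulmxE -exprD.
    rewrite subnKC // => /eqP; rewrite scalemx_eq0 (negPf vA) orbF.
    by move/eqP.
  case: (ltngtP k i) => [lt_ki|lt_ik|ek].
  - by rewrite -(inord_val k) IHi ?scale0r ?mul0mx // (leq_trans (ltnW lt_ki)).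
  - rewrite rowK -scalemxAl -mulmxA mulmxE -exprD A0i ?mulmx0 ?scaler0 //.
    by lia.
  - by case/eqP: ki; rewrite -ek inord_val.
apply: mxsim_sym; exists S, (invmx S).
by rewrite mulmxV // mulVmx // JS.
Qed.

(** * Powers of the homogeneous form at a pair of nilpotent blocks *)

(** The homogenization of q in degree D: the form y^D q(x / y). Multiplication of
    forms is that of the polynomials in one variable, so that powers of hsum d
    come from powers of 1 + z + ... + z^d. *)
Definition homog_mx (F : fieldType) m n (X : 'M[F]_m) (Y : 'M[F]_n) D
    (q : {poly F}) : 'M[F]_(m * n) :=
  \sum_(t < D.+1) q`_t *: (X ^+ t *t Y ^+ (D - t)).

Lemma homog_mx_monomial (F : fieldType) m n (X : 'M[F]_m) (Y : 'M[F]_n) D d j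
    (q : {poly F}) :
  (size q <= D.+1)%N -> (j <= d)%N ->
  homog_mx X Y D q *m (X ^+ j *t Y ^+ (d - j)) = homog_mx X Y (d + D) (q * 'X^j).
Proof.
move=> sz_q le_jd; rewrite /homog_mx mulmx_suml.
have e : (d + D).+1 = (j + (D.+1 + (d - j)))%N by lia.
pose G t := (q * 'X^j)`_t *: (X ^+ t *t Y ^+ (d + D - t)).
rewrite -(big_mkord xpredT G) e (big_cat_nat (n := j)) ?leq_addr //=.
rewrite [X in _ = X + _]big1_seq ?add0r => [|t]; last first.
  by rewrite mem_index_iota /G coefMXn => /andP[_ /andP[_ ->]]; rewrite scale0r.
rewrite (big_cat_nat (n := (j + D.+1)%N)) ?leq_addr ?leq_add2l //=; last first.
  exact: leq_addr.
rewrite [X in _ = _ + X]big1_seq ?addr0 => [|t]; last first.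
  rewrite mem_index_iota /G coefMXn => /and3P[_ le_t _].
  rewrite ifF; last by lia.
  by rewrite nth_default ?scale0r // (leq_trans sz_q) //; lia.
rewrite -[X in \sum_(X <= _ < _) _]add0n big_addn.
rewrite addKn big_mkord; apply: eq_bigr => t _.
rewrite /G coefMXn ifF; last by lia.
rewrite -scalemxAl tensmx_mul !mulmxE -!exprD addnK; congr (_ *: (_ *t _ ^+ _)).
by move: (ltn_ord t); lia.
Qed.

Lemma homog_mx_sum (F : fieldType) m n (X : 'M[F]_m) (Y : 'M[F]_n) D
    I (r : seq I) (P : pred I) (q : I -> {poly F}) :
  homog_mx X Y D (\sum_(i <- r | P i) q i) =
  \sum_(i <- r | P i) homog_mx X Y D (q i).
Proof.
rewrite /homog_mx exchange_big /=; apply: eq_bigr => t _.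
by rewrite coef_sum scaler_suml.
Qed.

Definition geom_poly (R : nzRingType) d : {poly R} := \sum_(a < d.+1) 'X^a.

Lemma size_geom_poly_exp (R : comNzRingType) d s :
  (size (geom_poly R d ^+ s) <= (s * d).+1)%N.
Proof.
have sz1 : (size (geom_poly R d) <= d.+1)%N.
  rewrite (leq_trans (size_sum _ _ _)) //; apply/bigmax_leqP => a _.
  by rewrite size_polyXn.
elim: s => [|s IHs]; first by rewrite expr0 size_poly1.
rewrite exprSr (leq_trans (size_polyMleq _ _)) //; lia.
Qed.

Lemma tens_hsum_exp (F : fieldType) m n (X : 'M[F]_m) (Y : 'M[F]_n) d s :
  (\sum_(j < d.+1) X ^+ j *t Y ^+ (d - j)) ^+ s =
  homog_mx X Y (s * d) (geom_poly F d ^+ s).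
Proof.
elim: s => [|s IHs].
  by rewrite /homog_mx mul0n big_ord1 !expr0 coef1 scale1r tens_scalar_mx1.
rewrite exprSr IHs -mulmxE mulmx_sumr exprSr [in RHS]/geom_poly mulr_sumr.
rewrite homog_mx_sum mulSn; apply: eq_bigr => j _.
by rewrite homog_mx_monomial ?size_geom_poly_exp // -ltnS.
Qed.

Lemma homog_jordanE (F : fieldType) m n D (q : {poly F})
    (i1 k1 : 'I_m) (i2 k2 : 'I_n) :
  homog_mx (jordan_block (m, 0 : F)) (jordan_block (n, 0 : F)) D q
     (mxtens_index (i1, i2)) (mxtens_index (k1, k2)) =
  if (k1 + k2 == i1 + i2 + D)%N && (i1 <= k1 <= i1 + D)%N then q`_(k1 - i1) else 0.
Proof.
rewrite summxE.
have E t : (q`_t *: (jordan_block (m, 0) ^+ t *t jordan_block (n, 0) ^+ (D - t)))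
     (mxtens_index (i1, i2)) (mxtens_index (k1, k2)) =
     if (i1 + t == k1)%N && (i2 + (D - t) == k2)%N then q`_t else 0.
  rewrite mxE tensmxE !jordan_block_expE !mxE -natrM mulnb.
  by case: ifP; rewrite ?mulr1 ?mulr0.
case: ifP => [/and3P[/eqP e le1 le2]|cF].
  have lt_t : (k1 - i1 < D.+1)%N by lia.
  rewrite (bigD1 (Ordinal lt_t)) //= big1 => [|t ne]; rewrite E /=.
    by rewrite addr0 ifT //; lia.
  rewrite ifF //; apply/negP => /andP[/eqP e1 _]; case/eqP: ne.
  by apply: val_inj => /=; lia.
rewrite big1 // => t _; rewrite E ifF //; apply/negP => /andP[/eqP e1 /eqP e2].
move/negP: cF; apply; move: (ltn_ord t) e1 e2 => /=; lia.
Qed.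

Lemma gammaE (F : fieldType) d s (i : nat) :
  (gamma d s i)%:~R = (geom_poly F d ^+ s)`_i.
Proof.
have -> : geom_poly F d ^+ s = map_poly intr (geom_poly int d ^+ s).
  rewrite rmorphXn rmorph_sum /=; congr (_ ^+ s); apply: eq_bigr => a _.
  by rewrite map_polyXn.
by rewrite coef_map.
Qed.

Lemma gamma_out d s (i : int) : ~~ (0 <= i <= (s * d)%N%:Z) -> gamma d s i = 0.
Proof.
case: i => [i|i] //= lt_i; rewrite nth_default //.
by apply: leq_trans (size_geom_poly_exp _ d s) _; lia.
Qed.

(** The shift structure of nilpotent blocks makes the coefficient of x^t y^(s d - t)
    appear exactly where the first index grows by t and the second by s d - t; the
    vanishing of gamma outside 0..sd takes care of the bounds on t. *)
Lemma hsum_jordanE (F : fieldType) m n d s (i1 k1 : 'I_m) (i2 k2 : 'I_n) :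
  ((\sum_(j < d.+1)
      jordan_block (m, 0 : F) ^+ j *t jordan_block (n, 0 : F) ^+ (d - j)) ^+ s)
     (mxtens_index (i1, i2)) (mxtens_index (k1, k2)) =
  if (k1 + k2 == i1 + i2 + s * d)%N then (gamma d s (k1%:Z - i1%:Z))%:~R else 0.
Proof.
rewrite tens_hsum_exp homog_jordanE; case: eqP => //= _.
case: ifP => [/andP[le1 le2]|/negbT out].
  by rewrite -gammaE; congr (gamma _ _ _)%:~R; lia.
by rewrite gamma_out //; move: out => /=; lia.
Qed.

(** * Ranks of graded matrices *)

Section Graded.
Variables (F : fieldType) (m n : nat).
Hypothesis le_mn : (m <= n)%N.

(** The total degree plus 1, which is the index k of the blocks R_k. *)
Definition grade (x : 'I_(m * n)) : nat :=
  ((mxtens_unindex x).1 + (mxtens_unindex x).2).+1.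

Fact grade_index_proof1 k (i : 'I_(udim m n k)) : (i + (k - n) < m)%N.
Proof. case: i => i /=; rewrite /udim !leq_min; lia. Qed.

Fact grade_index_proof2 k (i : 'I_(udim m n k)) : (k.-1 - (i + (k - n)) < n)%N.
Proof. case: i => i /=; rewrite /udim !leq_min; lia. Qed.

(** The monomials of degree k - 1 by increasing exponent of x, which starts at
    max(0, k - n) because the exponent of y is less than n. *)
Definition grade_index k (i : 'I_(udim m n k)) : 'I_(m * n) :=
  mxtens_index (Ordinal (grade_index_proof1 i), Ordinal (grade_index_proof2 i)).

Lemma grade_indexK k (i : 'I_(udim m n k)) : grade (grade_index i) = k.
Proof.
rewrite /grade mxtens_indexK; case: i => i /=; rewrite /udim !leq_min; lia.
Qed.

Lemma grade_indexP k x : grade x = k -> exists i : 'I_(udim m n k), x = grade_index i.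
Proof.
case: (mxtens_indexP x) => x1 x2; rewrite /grade mxtens_indexK /= => ek.
have lt_i : (x1 - (k - n) < udim m n k)%N.
  by rewrite /udim !leq_min; move: (ltn_ord x1) (ltn_ord x2); lia.
exists (Ordinal lt_i); congr (mxtens_index (_, _)); apply: val_inj => /=;
  move: (ltn_ord x1) (ltn_ord x2); lia.
Qed.

Lemma grade_index_inj k : injective (@grade_index k).
Proof.
move=> i j /(can_inj (@mxtens_indexK m n)) [e _]; apply: val_inj; exact: addIn e.
Qed.

Definition grade_proj k : 'M[F]_(m * n) := diag_mx (\row_x (grade x == k)%:R).

Lemma grade_projM k l :
  grade_proj k *m grade_proj l = if k == l then grade_proj k else 0.
Proof.
rewrite /grade_proj mul_diag_mx; apply/matrixP=> x y; rewrite !mxE.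
case: (eqVneq k l) => [<-|ne]; rewrite !mxE.
  by rewrite mulrnAr -natrM mulnb andbb.
case: (eqVneq (grade x) k) => [->|_]; last by rewrite mul0r.
by rewrite (negPf ne) mul0rn mulr0.
Qed.

Lemma sum_grade_proj : \sum_(k < m + n) grade_proj k = 1%:M.
Proof.
apply/matrixP=> x y; rewrite summxE !mxE.
have lt_x : (grade x < m + n)%N.
  by case: (mxtens_indexP x) => x1 x2; rewrite /grade mxtens_indexK /=;
    move: (ltn_ord x1) (ltn_ord x2); lia.
rewrite (bigD1 (Ordinal lt_x)) //= big1 => [|k ne]; rewrite !mxE.
  by rewrite eqxx addr0.
by rewrite -val_eqE eq_sym in ne; rewrite (negPf ne) mul0rn.
Qed.

Definition grade_rows k : 'M[F]_(udim m n k, m * n) := rowsub (@grade_index k) 1%:M.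
Definition grade_cols k : 'M[F]_(m * n, udim m n k) := colsub (@grade_index k) 1%:M.

Lemma grade_colsK k : grade_cols k *m grade_rows k = grade_proj k.
Proof.
apply/matrixP=> x y; rewrite !mxE.
case: (eqVneq (grade x) k) => [/[dup] gx /grade_indexP[i ex]|ne].
  rewrite (bigD1 i) //= big1 => [|j ji].
    by rewrite !mxE addr0 -ex eqxx mul1r.
  rewrite !mxE ex (inj_eq (@grade_index_inj k)) eq_sym (negPf ji).
  by rewrite mul0r.
rewrite big1 ?mul0rn // => i _; rewrite !mxE; case: eqP => [ex|]; last by rewrite mul0r.
by case/eqP: ne; rewrite ex grade_indexK.
Qed.

Lemma grade_rowsK k : grade_rows k *m grade_cols k = 1%:M.
Proof.
rewrite /grade_rows /grade_cols -mxsub_mul mul1mx.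
by apply/matrixP => i j; rewrite !mxE (inj_eq (@grade_index_inj k)).
Qed.

(** Up to the order of rows and columns, a matrix that raises the degree by D is
    block diagonal, with one block for each degree. *)
Lemma rank_graded (H : 'M[F]_(m * n)) D : (D < m + n)%N ->
  (forall x y, grade y != (grade x + D)%N -> H x y = 0) ->
  \rank H = (\sum_(D + 1 <= k < m + n)
     \rank (mxsub (@grade_index (k - D)%N) (@grade_index k) H))%N.
Proof.
move=> lt_D Hgr.
have EH k : (D < k)%N -> H *m grade_proj k = grade_proj (k - D)%N *m H.
  move=> lt_Dk; rewrite /grade_proj mul_diag_mx mul_mx_diag.
  apply/matrixP=> x y; rewrite !mxE.
  have [e|/Hgr ->] := eqVneq (grade y) (grade x + D)%N; last by rewrite mulr0 mul0r.
  rewrite mulrC e; congr (_%:R * _).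
  by rewrite -(eqn_add2r D (grade x)) subnK // ltnW.
have EH0 k : (k <= D)%N -> H *m grade_proj k = 0.
  move=> le_kD; rewrite /grade_proj mul_mx_diag.
  apply/matrixP=> x y; rewrite !mxE.
  have [e|/Hgr ->] := eqVneq (grade y) (grade x + D)%N; last by rewrite mul0r.
  by rewrite e (_ : (_ == k) = false) ?mulr0 // /grade; lia.
have rk k : (D < k)%N ->
    \rank (H *m grade_proj k) =
    \rank (mxsub (@grade_index (k - D)%N) (@grade_index k) H).
  move=> lt_Dk.
  have -> : mxsub (@grade_index (k - D)%N) (@grade_index k) H
      = grade_rows (k - D)%N *m (H *m grade_proj k) *m grade_cols k.
    rewrite -grade_colsK !mulmxA -[_ *m grade_rows k *m _]mulmxA grade_rowsK mulmx1.
    rewrite /grade_rows /grade_cols mulmx_colsub mulmx1 mul_rowsub_mx mul1mx.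
    by apply/matrixP=> i j; rewrite !mxE.
  apply/eqP; rewrite eqn_leq; apply/andP; split; last first.
    exact: leq_trans (mxrankM_maxl _ _) (mxrankM_maxr _ _).
  have e : H *m grade_proj k = grade_cols (k - D)%N *m
      (grade_rows (k - D)%N *m (H *m grade_proj k) *m grade_cols k) *m grade_rows k.
    rewrite !mulmxA grade_colsK -EH // -!mulmxA grade_colsK !mulmxA.
    by rewrite -!mulmxA !grade_projM eqxx grade_projM eqxx.
  rewrite [X in (\rank X <= _)%N]e.
  exact: leq_trans (mxrankM_maxl _ _) (mxrankM_maxr _ _).
(* The row space of H is the direct sum of those of its blocks, as the projections
   on the degrees are orthogonal idempotents. *)
have Hsum : (H :=: \sum_(k < m + n) (H *m grade_proj k))%MS.
  apply/eqmxP/andP; split.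
    rewrite -[X in (X <= _)%MS]mulmx1 -sum_grade_proj mulmx_sumr.
    by apply: summx_sub => k _; apply: (sumsmx_sup k).
  apply/sumsmx_subP => k _; have [/EH0 ->|/EH ->] := leqP k D; first exact: sub0mx.
  exact: submxMl.
have dxH : mxdirect (\sum_(k < m + n) (H *m grade_proj k)).
  apply/mxdirect_sumsP => k _; apply/eqP; rewrite -submx0; apply/row_subP => r.
  set V := (_ :&: _)%MS; move: (row r V) (row_sub r V) => u.
  rewrite sub_capmx => /andP[/submxP[v ev] /sub_sumsmxP[w ew]].
  rewrite submx0 ev -[grade_proj k](_ : grade_proj k *m grade_proj k = _); last first.
    by rewrite grade_projM eqxx.
  rewrite !mulmxA -[v *m H *m _]mulmxA -ev ew mulmx_suml big1 // => j /andP[_ ne].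
  by rewrite -!mulmxA grade_projM ifN ?mulmx0.
rewrite Hsum (mxdirectP dxH) /=.
rewrite -(big_mkord xpredT (fun k => \rank (H *m grade_proj k))).
rewrite (big_cat_nat (n := D.+1)) //= big1_seq ?add0n => [|k]; last first.
  by rewrite mem_index_iota /= ltnS => /EH0 ->; rewrite mxrank0.
rewrite addn1 big_nat_cond [RHS]big_nat_cond; apply: eq_bigr => k.
by rewrite andbT => /andP[lt_Dk _]; apply: rk.
Qed.

End Graded.

(** * Ranks of integer matrices in characteristic zero *)

Lemma ratr_frac (F : fieldType) (a b : int) : [pchar F] =i pred0 -> b != 0 ->
  ratr (a%:~R / b%:~R) = a%:~R / b%:~R :> F.
Proof.
move=> F0 b0; have int0 (z : int) : z != 0 -> z%:~R != 0 :> F.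
  by case: z => z z0; rewrite ?NegzE ?mulrNz ?oppr_eq0;
    move/pcharf0P: F0 => ->.
rewrite /ratr; set r : rat := a%:~R / b%:~R.
have : (numq r)%:~R / (denq r)%:~R = a%:~R / b%:~R :> rat by rewrite divq_num_den.
move/eqP; rewrite eqr_div ?intr_eq0 ?denq_neq0 // -!intrM => /eqP/intr_inj e.
apply/eqP; rewrite eqr_div ?int0 ?denq_neq0 //.
by rewrite -!intrM e.
Qed.

(** ratr is a ring morphism from rat to any field of characteristic 0, and ranks are
    invariant under field morphisms. *)
Lemma rank_int_pchar0 (F : fieldType) m n (A : 'M[int]_(m, n)) :
  [pchar F] =i pred0 ->
  \rank (map_mx (intr : int -> F) A) = \rank (map_mx (intr : int -> rat) A).
Proof.
move=> F0; have int0 (z : int) : z != 0 -> z%:~R != 0 :> F.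
  by case: z => z z0; rewrite ?NegzE ?mulrNz ?oppr_eq0;
    move/pcharf0P: F0 => ->.
have ratE x : exists a b : int, b != 0 /\ x = a%:~R / b%:~R :> rat.
  by exists (numq x), (denq x); rewrite denq_neq0 divq_num_den.
have raddr : zmod_morphism (ratr : rat -> F).
  move=> x y; have [a [b [b0 ->]]] := ratE x; have [c [e [e0 ->]]] := ratE y.
  rewrite -mulNr addf_div ?intr_eq0 // mulNr -!intrM -intrB !ratr_frac ?mulf_neq0 //.
  by rewrite -[in RHS]mulNr addf_div ?int0 // mulNr -!intrM -intrB.
have rmulr : monoid_morphism (ratr : rat -> F).
  split; first by rewrite (ratr_int _ 1).
  move=> x y; have [a [b [b0 ->]]] := ratE x; have [c [e [e0 ->]]] := ratE y.
  by rewrite mulf_div -!intrM !ratr_frac ?mulf_neq0 // mulf_div -!intrM.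
pose phiA := GRing.isZmodMorphism.Build rat F ratr raddr.
pose phiM := GRing.isMonoidMorphism.Build rat F ratr rmulr.
pose phi : {rmorphism rat -> F} := HB.pack ratr phiA phiM.
rewrite -[RHS](mxrank_map phi) -map_mx_comp; congr (\rank _).
by apply/matrixP=> i j; rewrite !mxE /= ratr_int.
Qed.

(** * The pair of Jordan blocks *)

(** Agrees with horner_alg, but makes sense for matrices of every size, including
    the product sizes of tensor products. *)
Definition polymx (F : fieldType) n (p : {poly F}) (A : 'M[F]_n) : 'M[F]_n :=
  \sum_(i < size p) p`_i *: A ^+ i.

Lemma polymxE (F : fieldType) n (p : {poly F}) (A : 'M[F]_n.+1) :
  polymx p A = horner_alg A p.
Proof. by rewrite (horner_algE A (leqnn _)). Qed.

Lemma divdiff_leading_mx (F : fieldType) K (A B : 'M[F]_K) m n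
    (c mu al c0 : F) (f w r : {poly F}) d L :
  GRing.comm A B -> (A - c%:M) ^+ m = 0 -> (B - c%:M) ^+ n = 0 ->
  w.[c] = 1 -> (size f <= L.+2)%N ->
  f = c0%:P + mu *: 'X + al *: (('X - c%:P) * w) ^+ d.+1
      + ('X - c%:P) ^+ (m + n) * r ->
  let W := polymx (('X - c%:P) * w) in
  exists2 U : 'M[F]_K, U \in unitmx /\ GRing.comm U (hsum d (W A) (W B)) &
    \sum_(i < L.+1) f`_i.+1 *: hsum i A B - mu%:M = al *: (U *m hsum d (W A) (W B)).
Proof.
case: K A B => [|K] A B AB A0 B0 w1 sz_f ef /=.
  exists 1%:M; last by rewrite [LHS]flatmx0 [RHS]flatmx0.
  by split; [exact: unitmx1 | apply/commr_sym/commr1].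
rewrite !polymxE.
have scal : c%:M = c%:A :> 'M[F]_K.+1 by rewrite -scalemx1.
rewrite scal in A0 B0.
have [U [uU cU] e] := divdiff_leading AB A0 B0 w1 ef.
exists U => //; rewrite -(divdiffE A B sz_f) mulmxE -e.
by rewrite -scalemx1.
Qed.

Lemma tensmxDr (R : pzRingType) m n p q (A : 'M[R]_(m, n)) (B C : 'M[R]_(p, q)) :
  A *t (B + C) = A *t B + A *t C.
Proof. by apply/matrixP => i j; rewrite !mxE mulrDr. Qed.

Lemma tensmxZl (R : pzRingType) m n p q c (A : 'M[R]_(m, n)) (B : 'M[R]_(p, q)) :
  (c *: A) *t B = c *: (A *t B).
Proof. by apply/matrixP => i j; rewrite !mxE mulrA. Qed.

Lemma tensmxZr (R : comPzRingType) m n p q c (A : 'M[R]_(m, n)) (B : 'M[R]_(p, q)) :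
  A *t (c *: B) = c *: (A *t B).
Proof. by apply/matrixP => i j; rewrite !mxE mulrCA. Qed.

Lemma tens_suml (R : pzRingType) m n p q I (r : seq I) (P : pred I)
    (A : I -> 'M[R]_(m, n)) (B : 'M[R]_(p, q)) :
  (\sum_(i <- r | P i) A i) *t B = \sum_(i <- r | P i) A i *t B.
Proof.
by apply: (big_morph (fun X => X *t B)) => [X Y|]; [exact: tensmxDl | exact: tens0mx].
Qed.

Lemma tens_sumr (R : pzRingType) m n p q I (r : seq I) (P : pred I)
    (A : 'M[R]_(m, n)) (B : I -> 'M[R]_(p, q)) :
  A *t (\sum_(i <- r | P i) B i) = \sum_(i <- r | P i) A *t B i.
Proof.
by apply: (big_morph (fun X => A *t X)) => [X Y|]; [exact: tensmxDr | exact: tensmx0].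
Qed.

Lemma tens_mx1X (F : fieldType) m n (A : 'M[F]_m) k :
  (A *t (1%:M : 'M[F]_n)) ^+ k = A ^+ k *t 1%:M.
Proof.
elim: k => [|k IHk]; first by rewrite !expr0 tens_scalar_mx1.
by rewrite !exprS IHk -!mulmxE tensmx_mul mulmx1.
Qed.

Lemma tens_1mxX (F : fieldType) m n (A : 'M[F]_n) k :
  ((1%:M : 'M[F]_m) *t A) ^+ k = 1%:M *t A ^+ k.
Proof.
elim: k => [|k IHk]; first by rewrite !expr0 tens_scalar_mx1.
by rewrite !exprS IHk -!mulmxE tensmx_mul mulmx1.
Qed.

Lemma polymx_tensl (F : fieldType) m n p (A : 'M[F]_m) :
  polymx p (A *t (1%:M : 'M[F]_n)) = polymx p A *t 1%:M.
Proof.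
rewrite /polymx tens_suml; apply: eq_bigr => i _; rewrite tens_mx1X.
by rewrite tensmxZl.
Qed.

Lemma polymx_tensr (F : fieldType) m n p (A : 'M[F]_n) :
  polymx p ((1%:M : 'M[F]_m) *t A) = 1%:M *t polymx p A.
Proof.
rewrite /polymx tens_sumr; apply: eq_bigr => i _; rewrite tens_1mxX.
by rewrite tensmxZr.
Qed.

Definition tens_hsum (F : fieldType) m n d (A : 'M[F]_m) (B : 'M[F]_n) :=
  \sum_(j < d.+1) A ^+ j *t B ^+ (d - j).

Lemma hsum_tens (F : fieldType) m n d (A : 'M[F]_m) (B : 'M[F]_n) :
  hsum d (A *t 1%:M) (1%:M *t B) = tens_hsum d A B.
Proof.
apply: eq_bigr => j _.
by rewrite tens_mx1X tens_1mxX -mulmxE tensmx_mul mulmx1 mul1mx.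
Qed.

Lemma tens_hsum_divdiff (F : fieldType) m n d (A : 'M[F]_m) (B : 'M[F]_n) :
  tens_hsum d A B = divdiff_mx d 'X^(d.+1) A B.
Proof.
rewrite /divdiff_mx big_ord_recr /= coefXn eqxx scale1r big1 ?add0r // => i _.
by rewrite coefXn eqSS ltn_eqF // scale0r.
Qed.

Lemma mxsim_tens_hsum (F : fieldType) m n p q d (A : 'M[F]_m) (B : 'M[F]_n)
    (C : 'M[F]_p) (D : 'M[F]_q) : mxsim A C -> mxsim B D ->
  mxsim (tens_hsum d A B) (tens_hsum d C D).
Proof. by rewrite !tens_hsum_divdiff; apply: mxsim_divdiff. Qed.

Lemma jordan_block_nil (F : fieldType) n (c : F) t : (n <= t)%N ->
  (jordan_block (n, c) - c%:M) ^+ t = 0.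
Proof.
move=> le_nt; apply/eqP; rewrite jordan_block_shift -mxrank_eq0.
by rewrite rank_jordan_block_exp subn_eq0.
Qed.

(** W = (X - c) w maps a Jordan block with eigenvalue c to a nilpotent of the same
    index, since w takes an invertible value. *)
Lemma polymx_jordan_block (F : fieldType) n (c : F) w : w.[c] = 1 ->
  mxsim (polymx (('X - c%:P) * w) (jordan_block (n, c))) (jordan_block (n, 0)).
Proof.
move=> w1; case: n => [|n]; first exact: mxsim_dim0.
rewrite polymxE rmorphM /= horner_alg_XsubC.
set J : 'M[F]_n.+1 := jordan_block (n.+1, c); set N := J - _.
have eN : N = J - c%:M by rewrite /N -scalemx1.
have N0 : N ^+ n.+1 = 0 by rewrite eN jordan_block_nil.
have cNJ : GRing.comm N J.
  by apply/commr_sym/commrB => //; apply/commr_sym/comm_alg.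
have cNw p : GRing.comm N (horner_alg J p) by apply: comm_horner_alg.
have Uw : horner_alg J w \is a GRing.unit by apply: horner_alg_unit N0 w1.
apply: mxsim_nilpotent; first by rewrite exprMn_comm // N0 mul0r.
rewrite exprMn_comm //; apply/eqP => /(congr1 (fun M => M * (horner_alg J w) ^- n)).
rewrite mulrK ?unitrX // mul0r eN => /eqP.
by rewrite jordan_block_shift -mxrank_eq0 rank_jordan_block_exp subSnn.
Qed.

Lemma divdiff_mx_hsum (F : fieldType) L f m n (A : 'M[F]_m) (B : 'M[F]_n) :
  divdiff_mx L f A B = \sum_(i < L.+1) f`_i.+1 *: hsum i (A *t 1%:M) (1%:M *t B).
Proof. by apply: eq_bigr => i _; rewrite hsum_tens. Qed.

Lemma exprZmx (F : fieldType) n (c : F) (A : 'M[F]_n) s :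
  (c *: A) ^+ s = c ^+ s *: A ^+ s.
Proof.
elim: s => [|s IHs]; first by rewrite !expr0 scale1r.
by rewrite !exprS IHs -!mulmxE -scalemxAl -scalemxAr scalerA.
Qed.

(** The change of variable W straightens the divided difference to a unit times its
    leading form, and W of a Jordan block is again a nilpotent Jordan block up to
    similarity; hence only the order d + 1 of f minus its tangent matters. *)
Lemma rank_divdiff_jordan (F : fieldType) L (f : {poly F}) m n d
    (c mu c0 : F) g s :
  [pchar F] =i pred0 -> (size f <= L.+2)%N -> g.[c] != 0 ->
  f = c0%:P + mu *: 'X + ('X - c%:P) ^+ d.+1 * g ->
  \rank ((divdiff_mx L f (jordan_block (m, c)) (jordan_block (n, c)) - mu%:M) ^+ s)
  = \rank (tens_hsum d (jordan_block (m, 0 : F)) (jordan_block (n, 0)) ^+ s).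
Proof.
move=> F0 sz_f g0 ef; set al := g.[c] in g0.
have [w [r [w1 eg]]] : exists w r, w.[c] = 1 /\
    al^-1 *: g = w ^+ d.+1 + ('X - c%:P) ^+ (m + n) * r.
  by apply: poly_root_approx => //; rewrite hornerZ mulVf.
set X := jordan_block (m, c); set Y := jordan_block (n, c).
have cXY : GRing.comm (X *t (1%:M : 'M[F]_n)) ((1%:M : 'M[F]_m) *t Y).
  by rewrite /GRing.comm -!mulmxE !tensmx_mul !mulmx1 !mul1mx.
have X0 : (X *t (1%:M : 'M[F]_n) - c%:M) ^+ m = 0.
  have -> : X *t 1%:M - c%:M = (X - c%:M) *t (1%:M : 'M[F]_n).
    have -> : (c%:M : 'M[F]_(m * n)) = c%:M *t 1%:M.
      by rewrite -(scalemx1 m c) tensmxZl tens_scalar_mx1 scalemx1.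
    by rewrite -scaleN1r -tensmxZl -tensmxDl scaleN1r.
  by rewrite tens_mx1X jordan_block_nil // tens0mx.
have Y0 : ((1%:M : 'M[F]_m) *t Y - c%:M) ^+ n = 0.
  have -> : 1%:M *t Y - c%:M = (1%:M : 'M[F]_m) *t (Y - c%:M).
    have -> : (c%:M : 'M[F]_(m * n)) = 1%:M *t c%:M.
      by rewrite -(scalemx1 n c) tensmxZr tens_scalar_mx1 scalemx1.
    by rewrite -scaleN1r -tensmxZr -tensmxDr scaleN1r.
  by rewrite tens_1mxX jordan_block_nil // tensmx0.
have ef' : f = c0%:P + mu *: 'X + al *: (('X - c%:P) * w) ^+ d.+1
      + ('X - c%:P) ^+ (m + n) * (al *: (('X - c%:P) ^+ d.+1 * r)).
  have eg' : g = al *: (w ^+ d.+1 + ('X - c%:P) ^+ (m + n) * r).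
    by rewrite -eg scalerA mulfV // scale1r.
  by rewrite {1}ef {1}eg' exprMn -!mul_polyC; ring.
have [U [uU cU]] := divdiff_leading_mx cXY X0 Y0 w1 sz_f ef'.
rewrite -divdiff_mx_hsum !polymx_tensl !polymx_tensr hsum_tens in cU * => ->.
set Z := tens_hsum _ _ _ in cU *.
have -> : \rank ((al *: (U *m Z)) ^+ s) = \rank (Z ^+ s).
  rewrite mulmxE exprZmx mxrank_scale_nz ?expf_neq0 // cU exprMn_comm; last first.
    exact: commr_sym.
  rewrite -mulmxE mxrankMfree // row_free_unit.
  elim: s => [|s IHs]; first by rewrite expr0 unitmx1.
  by rewrite exprS -mulmxE unitmx_mul uU.
have := mxsim_rank_exp 0 s
  (mxsim_tens_hsum d (polymx_jordan_block m w1) (polymx_jordan_block n w1)).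
have scal0 k : 0%:M = 0 :> 'M[F]_k by rewrite -scalemx1 scale0r.
by rewrite !scal0 !subr0.
Qed.

(** The block of degree k - 1 is R_k: the entry at (i, j) is the coefficient of index
    (j + max(0, k - n)) - (i + max(0, k - s d - n)), which is the shift c_k. *)
Lemma rank_tens_hsum_jordan (F : fieldType) m n d s :
  [pchar F] =i pred0 -> (m <= n)%N ->
  \rank (tens_hsum d (jordan_block (m, 0 : F)) (jordan_block (n, 0)) ^+ s) =
  (\sum_(s * d + 1 <= k < m + n) rho k m n d s)%N.
Proof.
move=> F0 le_mn; set H := tens_hsum _ _ _ ^+ s.
have HE i1 i2 k1 k2 : H (mxtens_index (i1, i2)) (mxtens_index (k1, k2)) =
    if (k1 + k2 == i1 + i2 + s * d)%N then (gamma d s (k1%:Z - i1%:Z))%:~R else 0.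
  exact: hsum_jordanE.
have [lt_D|le_D] := ltnP (s * d) (m + n).
  rewrite (rank_graded le_mn lt_D) => [|x y]; last first.
    case: (mxtens_indexP x) => i1 i2; case: (mxtens_indexP y) => k1 k2.
    rewrite HE /grade !mxtens_indexK /= addSn eqSS => /negPf -> //.
  rewrite big_nat_cond [RHS]big_nat_cond; apply: eq_bigr => k /andP[/andP[lt_Dk _] _].
  rewrite /rho -(rank_int_pchar0 _ F0); congr (\rank _).
  apply/matrixP => i j; rewrite mxE HE /= !mxE.
  have := ltn_ord i; have := ltn_ord j; rewrite /udim !leq_min => lt_j lt_i.
  rewrite ifT; last by lia.
  congr (gamma d s _)%:~R; rewrite /cshift.
  by case: ifP => h1; [|case: ifP => h2]; lia.
rewrite big_geq; last by rewrite addn1 ltnW.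
apply/eqP; rewrite mxrank_eq0; apply/eqP/matrixP => x y.
case: (mxtens_indexP x) => i1 i2; case: (mxtens_indexP y) => k1 k2.
rewrite HE mxE ifF //; move: (ltn_ord k1) (ltn_ord k2) => /=; lia.
Qed.

(** * The order of the tangent contact, and the theorem *)

Lemma divdiff_poly_const (F : fieldType) L (f : {poly F}) (c : F) :
  [pchar F] =i pred0 -> (phi f c)^`() = 0 -> divdiff_poly L f = (f`_1)%:P%:P.
Proof.
move=> F0 phi0.
have f0 i : f`_i.+2 = 0.
  have := congr1 (fun p : {poly F} => p`_i.+1) phi0.
  rewrite derivB derivM derivX derivC mulr0 addr0 mul1r coef0 coefB coefC subr0.
  rewrite coef_deriv -mulr_natr => /eqP; rewrite mulf_eq0.
  by move/pcharf0P: F0 => -> /orP[/eqP|].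
rewrite /divdiff_poly big_ord_recl big_ord1 !expr0 !mulr1 big1 ?addr0 // => i _.
by rewrite /= f0 !polyC0 mul0r.
Qed.

(** In characteristic 0 a root of order d + 1 of phi - phi(c) is a root of order d of
    the derivative. *)
Lemma phi_deriv_order (F : fieldType) (f : {poly F}) (c : F) :
  [pchar F] =i pred0 -> (phi f c)^`() != 0 ->
  let d := mup c (phi f c)^`() in
  (0 < d)%N /\ exists c0 g, g.[c] != 0 /\
    f = c0%:P + f^`().[c] *: 'X + ('X - c%:P) ^+ d.+1 * g.
Proof.
move=> F0 phi0 d; set mu := f^`().[c].
have ephi : (phi f c)^`() = f^`() - mu%:P.
  by rewrite derivB derivM derivX derivC mulr0 addr0 mul1r.
split.
  rewrite -XsubC_dvd // -root_factor_theorem /root ephi.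
  by rewrite hornerD hornerN hornerC subrr.
set p0 := phi f c - (phi f c).[c]%:P.
have dp0 : p0^`() = (phi f c)^`() by rewrite derivB derivC subr0.
have p0n : p0 != 0 by apply: contraNneq phi0 => p00; rewrite -dp0 p00 deriv0.
have [[|k] [g]] := multiplicity_XsubC p0 c; rewrite p0n /= => gc ep.
  case/negP: gc; rewrite expr0 mulr1 in ep.
  by rewrite -ep /root hornerD hornerN hornerC subrr.
have dk : d = k.
  have e : (phi f c)^`() = ('X - c%:P) ^+ k * (g^`() * ('X - c%:P) + g *+ k.+1).
    rewrite -dp0 ep derivM deriv_exp derivXsubC mul1r /= exprSr [RHS]mulrDr.
    by congr (_ + _); [rewrite mulrA mulrAC mulrC -mulrA | rewrite !mulrnAr mulrC].
  apply/eqP; rewrite eqn_leq /d; apply/andP; split; last first.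
    by rewrite mup_geq // e dvdp_mulr.
  rewrite -ltnS mup_ltn // e exprSr dvdp_mul2l ?expf_neq0 ?polyXsubC_eq0 //.
  rewrite -root_factor_theorem /root hornerD hornerM hornerXsubC subrr mulr0 add0r.
  rewrite hornerMn -mulr_natr mulf_neq0 //.
  by move/pcharf0P: F0 => ->.
exists (phi f c).[c], g; split; first by [].
rewrite dk [_ ^+ _ * g]mulrC -ep /p0; set a := _%:P.
by rewrite /phi -mul_polyC; ring.
Qed.

(** frakN is the nullity of the s-th power: the convention m n in the range
    s d >= m + n - 1 is the vanishing of forms of that degree on the blocks. *)
Lemma frakN_rank (F : fieldType) L (f : {poly F}) m n d (c c0 : F) g s :
  [pchar F] =i pred0 -> (size f <= L.+2)%N -> g.[c] != 0 -> (0 < d)%N ->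
  f = c0%:P + f^`().[c] *: 'X + ('X - c%:P) ^+ d.+1 * g ->
  (frakN (minn m n) (maxn m n) d s +
   (\rank ((divdiff_mx L f (jordan_block (m, c)) (jordan_block (n, c))
            - (f^`().[c])%:M) ^+ s))%:Z)%R = (m * n)%:Z.
Proof.
move=> F0 sz_f g0 d0 ef; set mu := f^`().[c] in ef *.
pose G k l := divdiff_mx L f (jordan_block (k, c)) (jordan_block (l, c)).
rewrite -/(G m n).
have -> : \rank ((G m n - mu%:M) ^+ s)
    = \rank ((G (minn m n) (maxn m n) - mu%:M) ^+ s).
  have [le_mn|lt_nm] := leqP m n; first by [].
  exact: mxsim_rank_exp (mxsim_divdiffC _ _ _ _).
have -> : (m * n = minn m n * maxn m n)%N.
  by have [//|_] := leqP m n; rewrite mulnC.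
have le_mM : (minn m n <= maxn m n)%N by rewrite geq_min leq_max leqnn.
move: (minn m n) (maxn m n) le_mM => {}m {}n le_mn; rewrite /G.
rewrite (rank_divdiff_jordan _ _ _ F0 sz_f g0 ef).
case: s => [|s]; first by rewrite /frakN eqxx expr0 mxrank1 add0r.
rewrite rank_tens_hsum_jordan // /frakN /= muln_gt0 d0 /=.
case: ifP => lt_D.
  by rewrite (big_morph Posz PoszD (erefl _)) [(d * _)%N]mulnC subrK.
by rewrite big_geq ?addr0 //; lia.
Qed.

Theorem theorem4p12 (F : closedFieldType) (charF0 : [pchar F] =i pred0)
    (L : nat) (f : {poly F}) (sz_f : (size f <= L.+2)%N)
    (p_nonconstant : forall c : F, divdiff_poly L f <> c%:P%:P)
    (M N : nat) (X : 'M[F]_M) (Y : 'M[F]_N) (jX jY : seq (nat * F))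
    (jordX : jordan_form X jX) (jordY : jordan_form Y jY)
    (* b u v lists the blocks associated with the pair (u, v) *)
    (b : nat * F -> nat * F -> seq (nat * F))
    (jordb : forall u v, u \in jX -> v \in jY ->
       jordan_form (divdiff_mx L f (jordan_block u) (jordan_block v)) (b u v)) :
  jordan_form (divdiff_mx L f X Y) (flatten [seq b u v | u <- jX, v <- jY]) /\
  forall (mX nY : nat) (lambda : F),
    (mX, lambda) \in jX -> (nY, lambda) \in jY ->
    let m := minn mX nY in
    let n := maxn mX nY in
    let d := mup lambda (phi f lambda)^`() in
    let mu := f^`().[lambda] in
    let blocks := b (mX, lambda) (nY, lambda) in
    ((m + n - 1 <= d)%N -> blocks = nseq (m * n) (1%N, mu)) /\
    ((d < m + n - 1)%N ->
       all (fun u => u.2 == mu) blocks /\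
       forall s : nat, (1 <= s)%N ->
         (count_mem (s, mu) blocks)%:Z =
           2 * frakN m n d s - frakN m n d s.-1 - frakN m n d s.+1).
Proof.
split; first exact: jordan_divdiff.
move=> mX nY lambda uX vY m n d mu blocks.
have jG := jordb _ _ uX vY; rewrite -/blocks in jG.
set G := divdiff_mx _ _ _ _ in jG.
have phi0 : (phi f lambda)^`() != 0.
  by apply/eqP => /(divdiff_poly_const L charF0) /p_nonconstant.
have [d0 [c0 [g [gc ef]]]] := phi_deriv_order charF0 phi0.
rewrite -/d in d0 ef.
have mnE : (mX * nY = m * n)%N.
  by rewrite /m /n; have [//|_] := leqP mX nY; rewrite mulnC.
have rkN s : frakN m n d s + (\rank ((G - mu%:M) ^+ s))%:Z = (m * n)%:Z.
  by rewrite -mnE; apply: (frakN_rank mX nY s charF0 sz_f gc d0 ef).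
have rk0 s : (m + n - 1 <= s * d)%N -> (0 < s)%N -> (G - mu%:M) ^+ s = 0.
  move=> le_D s0; apply/eqP; rewrite -mxrank_eq0; have := rkN s.
  rewrite /frakN (gtn_eqF s0) ifN; last by rewrite negb_and -!leqNgt le_D orbT.
  lia.
have muB : all (fun u => u.2 == mu) blocks.
  apply: jordan_form_eigenvalues jG (rk0 (m + n).+1 _ _) => //.
  by rewrite (leq_trans _ (leq_pmulr _ d0)) //; lia.
split=> [le_d|lt_d].
  have := jordan_form_rank 1 jG muB; rewrite (rk0 1%N) ?mul1n // mxrank0 => /esym/eqP.
  rewrite sum_nat_seq_eq0 => /allP B1.
  have [/allP Bpos _] := jG.
  have {}B1 : blocks = nseq (size blocks) (1%N, mu).
    apply/all_pred1P/allP => -[k a] ub; have /eqP/= -> := allP muB _ ub.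
    have /= := B1 _ ub; have /= := Bpos _ ub; case: k {ub} => [|[|k]] //.
  rewrite B1; congr nseq; have := jordan_form_size jG.
  by rewrite B1 big_nseq -mnE /= iter_addn addn0 mul1n size_nseq.
split=> // s s0.
have cnt : (count_mem (s, mu) blocks + 2 * \rank ((G - mu%:M) ^+ s) =
    \rank ((G - mu%:M) ^+ s.-1) + \rank ((G - mu%:M) ^+ s.+1))%N.
  exact: jordan_form_count jG muB s0.
move: cnt (rkN s) (rkN s.-1) (rkN s.+1).
move: (\rank _) (\rank _) (\rank _) (count_mem _ _).
by move: (frakN _ _ _ _) (frakN _ _ _ _) (frakN _ _ _ _); lia.
Qed.
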